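(* Fix an integer $K\ge 1$, $\eta\in (0,1/2)$, and $\tau\in (0,1)$. Let $B_1, B_2, \dots$ be a $(d,\eta)$-small sequence of Bohr sets. Let $f:G\to [0,1]$ satisfy $\|f\|_{(B_1,B_2,B_3,K,K)}\ge \tau$. Then for any $\varepsilon > 0$ there exist $g_1:B_2\to [0,1]$, $g_2:B_3\to [0,1]$, and $x\in B_1$ such that \[\mathbb{E}_{y\sim B_2,\,z\sim B_3}[g_1(y)g_2(z)f(x + y + z)]\ge (1-\varepsilon) \cdot \tau \cdot \mathbb{E}_{y\sim B_2,\,z\sim B_3}[g_1(y)g_2(z)]\] and $\mathbb{E}[g_i]\ge \varepsilon \cdot \tau^{O(K)}$ for $i=1,2$.
   Context: $G$ is a finite abelian group. A Bohr set $\Lambda_{\Theta,\nu}=\{x\in G: \|\Theta_i(x)\|_{\mathbb{R}/\mathbb{Z}}\le \nu\ \forall i\}$ for characters $\Theta_1,\dots,\Theta_d$ has rank $d$ and radius $\nu$; it is regular if $1-100d|c|\le |(1+c)\Lambda|/|\Lambda|\le 1+100d|c|$ for all $|c|\le 1/(100d)$. A sequence $B_1,B_2,\dots$ is $(d,\eta)$-small if all $B_i$ are regular Bohr sets with the same $d$ frequencies and $\nu(B_{i+1})/\nu(B_i)\le\eta$. Expectations are uniform over the indicated Bohr set. The Gowers grid norm is $\|f\|_{(B_1,B_2,B_3,k,\ell)}^{k\ell}=\mathbb{E}_{x\sim B_1,\,y_1,\dots,y_k\sim B_2,\,z_1,\dots,z_\ell\sim B_3}\prod_{i\in[k],j\i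n[\ell]}f(x+y_i+z_j)$.
   Formalization: The formal theorem takes 0 < ε ≤ 1 instead of any ε > 0: for ε > τ^{-CK} the bound E[g_i] ≥ ε·τ^{CK} would exceed 1, which is impossible for g_i ≤ 1, and for ε > 1 the first inequality is vacuous. *)

(* Defs.v *)
From HB Require Import structures.
From mathcomp Require Import all_boot all_order all_algebra.
From mathcomp Require Import generic_quotient ring_quotient.
From mathcomp Require Import reals exp.

Set Implicit Arguments.
Unset Strict Implicit.
Unset Printing Implicit Defensive.

Import Order.TTheory GRing.Theory Num.Theory.

Local Open Scope ring_scope.

(** The circle group R/Z: the quotient of the additive group of [R] by its
    subgroup of integers, with canonical projection [\pi_(circle R)]. *)
Notation int_subgroup R :=
  (GRing.ZmodClosed.clone _ (@Num.int_num_subdef R) _).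

Notation circle R := (@Quotient.quot R (int_subgroup R)).

(** Distance from [t] to the nearest integer. *)
Definition dist_int (R : realType) (t : R) : R :=
  Num.min (t - (Num.floor t)%:~R) ((Num.floor t)%:~R + 1 - t).

(** This is [dist_int] of any representative: see [circle_normE]. *)
Definition circle_norm (R : realType) (u : circle R) : R := dist_int (repr u).

Lemma circle_normE (R : realType) (t : R) :
  circle_norm (\pi_(circle R)%qT t) = dist_int t.
Proof.
rewrite /circle_norm.
have : (repr (\pi_(circle R)%qT t) - t) \is a Num.int.
  have /eqP := reprK (\pi_(circle R)%qT t).
  by rewrite -Quotient.idealrBE.
move=> /intrP[m /eqP]; rewrite subr_eq => /eqP ->.
rewrite /dist_int real_floorDzr ?num_real ?intr_int// intrKfloor intrD.
have e (a b : R) : m%:~R + a - (m%:~R + b) = a - b.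
  by rewrite opprD addrACA subrr add0r.
by rewrite -[_ + _ + 1]addrA !e.
Qed.

(** The data of a Bohr set of rank [d]: the characters Theta_i and the radius
    nu. Regularity and dilation depend on these and not only on the underlying
    set [bohr_set]. *)
Record bohr (R : realType) (G : finZmodType) (d : nat) := Bohr {
  freq : 'I_d -> {additive G -> circle R};
  radius : R;
  radius_gt0 : 0 < radius
}.

Section BohrSets.
Variables (R : realType) (G : finZmodType) (d : nat).
Implicit Type B : bohr R G d.

Definition bohr_of (Theta : 'I_d -> {additive G -> circle R}) (nu : R) :
  {set G} := [set x | [forall i, circle_norm (Theta i x) <= nu]].

Definition bohr_set B : {set G} := bohr_of (freq B) (radius B).

(** The dilate rB keeps the characters and multiplies the radius by r. *)
Definition dilate (r : R) B : {set G} := bohr_of (freq B) (r * radius B).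

Definition regular B : Prop :=
  forall c : R, `|c| <= 1 / (100 * d%:R) ->
    1 - 100 * d%:R * `|c| <= #|dilate (1 + c) B|%:R / #|bohr_set B|%:R
      <= 1 + 100 * d%:R * `|c|.

(** Sequences are indexed from 0: [B 0] is the first term B_1. *)
Definition small_seq (eta : R) (B : nat -> bohr R G d) : Prop :=
  [/\ forall n, regular (B n),
      forall n i, freq (B n) i =1 freq (B 0%N) i
    & forall n, radius (B n.+1) / radius (B n) <= eta].

End BohrSets.

(** Expectation of [F x] for [x] uniform in [A]. *)
Definition avg (R : realType) (T : finType) (A : {set T}) (F : T -> R) : R :=
  (\sum_(x in A) F x) / #|A|%:R.

Notation "'\avg_' ( x 'in' A ) F" := (avg A (fun x => F))
  (at level 41, F at level 41, x binder,
   format "'[' '\avg_' ( x  'in'  A ) '/  '  F ']'") : ring_scope.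

(** k-tuples with all entries in [A], so that [avg] over [tuples k A] is the
    expectation over k independent uniform elements of [A]. *)
Definition tuples (T : finType) (k : nat) (A : {set T}) :
  {set {ffun 'I_k -> T}} := [set y : {ffun 'I_k -> T} | [forall i, y i \in A]].

Definition grid_avg (R : realType) (G : finZmodType) (f : G -> R)
  (A1 A2 A3 : {set G}) (k l : nat) : R :=
  \avg_(x in A1) \avg_(y in tuples k A2) \avg_(z in tuples l A3)
    \prod_(i < k) \prod_(j < l) f (x + y i + z j).

(** The (k * l)-th root of [grid_avg]; meant for nonnegative [f], for which
    [grid_avg] is nonnegative, and for positive k and l. *)
Definition grid_norm (R : realType) (G : finZmodType) (f : G -> R)
  (A1 A2 A3 : {set G}) (k l : nat) : R :=
  grid_avg f A1 A2 A3 k l `^ (k * l)%:R^-1.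

(* Main.v *)
(** Fix [x] in [B1] where the average over [B1] is attained or exceeded, and put
    [F y z = f (x + y + z)]. Telescoping the grid averages with K rows and
    l = 0, ..., K columns gives an l for which adding a column costs at most a
    factor tau^K; telescoping again over the K edges of that column gives an
    edge which costs at most a factor tau. Conditioning on all vertices except
    the two ends of this edge, the edges already present form
    [const * g1 y * g2 z], and the inequality at the edge is the density
    increment on average over the conditioning. Configurations in which [g1]
    or [g2] has mean below eps tau^(2K) contribute too little to matter,
    provided that tau^K < (1 - eps) tau. Otherwise [g1 = g2 = 1] works, since
    keeping only K disjoint edges of the grid shows that [F] has mean at least
    tau^K. *)

Require Import Defs.
From HB Require Import structures.
From mathcomp Require Import all_boot all_order all_algebra.
From mathcomp Require Import reals exp.
From mathcomp Require Import ring lra zify.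

Set Implicit Arguments.
Unset Strict Implicit.
Unset Printing Implicit Defensive.

Import Order.TTheory GRing.Theory Num.Theory.

Local Open Scope ring_scope.

(** * Uniform averages over finite sets and tuples *)

Lemma eq_avg (R : realType) (T : finType) (A : {set T}) (F H : T -> R) :
  (forall x, x \in A -> F x = H x) -> avg A F = avg A H.
Proof. by move=> FH; rewrite /avg (eq_bigr H). Qed.

Lemma le_avg (R : realType) (T : finType) (A : {set T}) (F H : T -> R) :
  (forall x, x \in A -> F x <= H x) -> avg A F <= avg A H.
Proof. by move=> FH; rewrite /avg ler_wpM2r ?invr_ge0 ?ler0n// ler_sum. Qed.

Lemma avg_ge0 (R : realType) (T : finType) (A : {set T}) (F : T -> R) :
  (forall x, x \in A -> 0 <= F x) -> 0 <= avg A F.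
Proof. by move=> F0; rewrite /avg divr_ge0 ?sumr_ge0 ?ler0n. Qed.

Lemma avgZ (R : realType) (T : finType) (A : {set T}) (c : R) (F : T -> R) :
  avg A (fun x => c * F x) = c * avg A F.
Proof. by rewrite /avg -mulr_sumr mulrA. Qed.

Lemma avgD (R : realType) (T : finType) (A : {set T}) (F H : T -> R) :
  avg A (fun x => F x + H x) = avg A F + avg A H.
Proof. by rewrite /avg big_split mulrDl. Qed.

Lemma avg_cst (R : realType) (T : finType) (A : {set T}) (c : R) :
  A != set0 -> avg A (fun=> c) = c.
Proof.
move=> A0; rewrite /avg sumr_const -[c *+ _]mulr_natr mulfK//.
by rewrite pnatr_eq0 cards_eq0.
Qed.

Lemma avg_le_cst (R : realType) (T : finType) (A : {set T}) (F : T -> R)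
    (c : R) :
  0 <= c -> (forall x, x \in A -> F x <= c) -> avg A F <= c.
Proof.
move=> c0 Fc; have [->|A0] := eqVneq A set0.
  by rewrite /avg big_set0 mul0r.
by rewrite -[leRHS](avg_cst c A0) le_avg.
Qed.

(** Positivity of [c] rules out the empty set, whose average is 0 by convention. *)
Lemma exists_ge_avg (R : realType) (T : finType) (A : {set T}) (F : T -> R)
    (c : R) :
  0 < c -> c <= avg A F -> exists2 x, x \in A & c <= F x.
Proof.
move=> c0 cF; have A0 : A != set0.
  by apply: contraTneq cF => ->; rewrite /avg big_set0 mul0r -ltNge.
case: (boolP [exists x in A, c <= F x]) => [/exists_inP//|].
rewrite negb_exists_in => /forall_inP Fc.
have [y yA] := set0Pn _ A0.
have : avg A F < c; last by rewrite ltNge cF.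
rewrite /avg ltr_pdivrMr ?ltr0n ?card_gt0// mulr_natr -sumr_const.
rewrite (bigD1 y)//= [ltRHS](bigD1 y)//= ltr_leD//; first by rewrite ltNge Fc.
by apply: ler_sum => x /andP[xA _]; rewrite ltW// ltNge Fc.
Qed.

Lemma exchange_avg (R : realType) (S T : finType) (A : {set S}) (D : {set T})
    (F : S -> T -> R) :
  avg A (fun x => avg D (F x)) = avg D (fun y => avg A (F^~ y)).
Proof. by rewrite /avg -!mulr_suml exchange_big mulrAC. Qed.

(** Independence of the coordinates: expanding a product of sums runs over all tuples. *)
Lemma avg_tuples_prod (R : realType) (T : finType) (A : {set T}) (k : nat)
    (F : 'I_k -> T -> R) :
  avg (tuples k A) (fun y => \prod_i F i (y i)) = \prod_i avg A (F i).
Proof.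
have tE (y : {ffun 'I_k -> T}) : (y \in tuples k A) = (y \in ffun_on (mem A)).
  by rewrite inE; apply/forallP/ffun_onP.
rewrite /avg (eq_bigl _ _ tE) (eq_card tE) card_ffun_on card_ord.
by rewrite big_split/= bigA_distr_big prodr_const card_ord natrX exprVn.
Qed.

Lemma avg_tuples_exp (R : realType) (T : finType) (A : {set T}) (k : nat)
    (F : T -> R) :
  avg (tuples k A) (fun y => \prod_i F (y i)) = avg A F ^+ k.
Proof.
by rewrite (avg_tuples_prod A (fun=> F)) prodr_const card_ord.
Qed.

(** Telescoping: if the last step fails, dividing by [c] passes the hypothesis down to [n]. *)
Lemma exists_ratio_ge (R : realFieldType) (u : nat -> R) (c : R) (n : nat) :
  0 < c -> (0 < n)%N -> c ^+ n * u 0%N <= u n ->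
  exists2 l, (l < n)%N & c * u l <= u l.+1.
Proof.
move=> c0; elim: n => // n IHn _ cn.
have [?|un] := lerP (c * u n) (u n.+1); first by exists n.
case: n => [|n] in IHn cn un *; first by move: un; rewrite ltNge cn.
have [|l ln cl] := IHn isT; last by exists l => //; apply: ltnW.
by rewrite -(ler_pM2l c0) mulrA -exprS (le_trans cn (ltW un)).
Qed.

Lemma prod01 (R : realDomainType) (I : finType) (F : I -> R) :
  (forall i, 0 <= F i <= 1) -> 0 <= \prod_i F i <= 1.
Proof.
by move=> F01; rewrite prodr_ge0 ?prodr_ile1// => i _; have /andP[] := F01 i.
Qed.

(** * Grid averages of a function of two variables *)

Definition grid2 (R : realType) (Y Z : finType) (F : Y -> Z -> R)
    (A : {set Y}) (D : {set Z}) (k l : nat) : R :=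
  avg (tuples k A) (fun y => avg (tuples l D) (fun z =>
    \prod_i \prod_j F (y i) (z j))).

Lemma grid2_row (R : realType) (Y Z : finType) (F : Y -> Z -> R)
    (A : {set Y}) (D : {set Z}) (k l : nat) :
  grid2 F A D k l =
  avg (tuples k A) (fun y => avg D (fun z => \prod_i F (y i) z) ^+ l).
Proof.
apply: eq_avg => y _; rewrite -avg_tuples_exp.
by apply: eq_avg => z _; rewrite exchange_big.
Qed.

Lemma grid2_col (R : realType) (Y Z : finType) (F : Y -> Z -> R)
    (A : {set Y}) (D : {set Z}) (k l : nat) :
  grid2 F A D k l =
  avg (tuples l D) (fun z => avg A (fun y => \prod_j F y (z j)) ^+ k).
Proof.
rewrite /grid2 exchange_avg; apply: eq_avg => z _.
by rewrite -avg_tuples_exp.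
Qed.

(** One column vertex is singled out as [z]; once all column vertices are fixed, the [k] rows are
    independent. *)
Lemma grid2_row_split (R : realType) (Y Z : finType) (F : Y -> Z -> R)
    (A : {set Y}) (D : {set Z}) (k l : nat) :
  grid2 F A D k l.+1 =
  avg (tuples l D) (fun zs => avg D (fun z =>
    avg A (fun y => (\prod_j F y (zs j)) * F y z) ^+ k)).
Proof.
rewrite grid2_row; under [RHS]eq_avg => zs _.
  under eq_avg => z _ do rewrite -avg_tuples_exp.
  rewrite exchange_avg; over.
rewrite [RHS]exchange_avg; apply: eq_avg => y _.
under [RHS]eq_avg => zs _.
  under eq_avg => z _ do rewrite big_split/=.
  rewrite avgZ mulrC exchange_big; over.
by rewrite avgZ exprS
  -(avg_tuples_exp D l (fun z => \prod_i F (y i) z)).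
Qed.

(** Off-diagonal factors are at most 1, and the diagonal ones involve disjoint pairs of
    coordinates. *)
Lemma grid2_le_diag (R : realType) (Y Z : finType) (F : Y -> Z -> R)
    (A : {set Y}) (D : {set Z}) (k : nat) :
  (forall y z, 0 <= F y z <= 1) ->
  grid2 F A D k k <= avg A (fun y => avg D (F y)) ^+ k.
Proof.
move=> F01; rewrite -avg_tuples_exp /grid2; apply: le_avg => y _.
rewrite -(avg_tuples_prod D (fun i => F (y i))).
apply: le_avg => z _; apply: ler_prod => i _.
have /andP[F0 _] := F01 (y i) (z i).
have P01 := prod01 (fun j => F01 (y i) (z j)); rewrite (andP P01).1/=.
rewrite (bigD1 i)//= ler_piMr// prodr_ile1// => j _; exact: F01.
Qed.

(** * Density increment at a single edge *)

(** Configurations with a mean below [delta] are discarded. In the last hypothesis,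
    [delta * grid2 F A D k l] pays for a small mean of [g2] and [delta ^+ k] for a small mean of
    [g1]. *)
Lemma exists_dense_weights (R : realType) (Y Z : finType) (F : Y -> Z -> R)
    (A : {set Y}) (D : {set Z}) (k l : nat) (tau eps delta : R) :
  A != set0 -> D != set0 ->
  (forall y z, 0 <= F y z <= 1) -> (0 < k)%N -> 0 < tau -> 0 <= eps <= 1 ->
  0 <= delta ->
  tau ^+ k * grid2 F A D k l <= grid2 F A D k l.+1 ->
  delta * grid2 F A D k l + delta ^+ k
    < eps * tau * (tau ^+ k * grid2 F A D k l) ->
  exists (g1 : Y -> R) (g2 : Z -> R),
    [/\ forall y, 0 <= g1 y <= 1, forall z, 0 <= g2 z <= 1,
        (1 - eps) * tau * (avg A g1 * avg D g2)
          <= avg A (fun y => avg D (fun z => g1 y * g2 z * F y z)),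
        delta <= avg A g1 & delta <= avg D g2].
Proof.
move=> A0 D0 F01 k0 tau0 /andP[eps0 eps1] delta0 step small.
pose G (zs : {ffun 'I_l -> Z}) y := \prod_j F y (zs j).
have G01 zs y : 0 <= G zs y <= 1 by apply: prod01.
have G0 zs y : 0 <= G zs y by have /andP[] := G01 zs y.
have F0 y z : 0 <= F y z by have /andP[] := F01 y z.
have F1 y z : F y z <= 1 by have /andP[] := F01 y z.
pose a zs := avg A (G zs).
have a0 zs : 0 <= a zs by apply: avg_ge0.
pose c zs z := avg A (fun y => G zs y * F y z).
have c0 zs z : 0 <= c zs z by apply: avg_ge0 => y _; apply: mulr_ge0.
have ca zs z : c zs z <= a zs by apply: le_avg => y _; rewrite ler_piMr.
(* The grid average once [i] of the [k] edges at a new column vertex [z] have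
   been added. *)
pose S i := avg (tuples l D) (fun zs =>
  avg D (fun z => a zs ^+ (k - i) * c zs z ^+ i)).
set M := grid2 F A D k l in step small *.
have S0 : S 0%N = M.
  rewrite /M grid2_col; apply: eq_avg => zs _.
  by rewrite subn0 -[RHS](avg_cst _ D0); apply: eq_avg => z _; rewrite mulr1.
have Sk : S k = grid2 F A D k l.+1.
  rewrite grid2_row_split; apply: eq_avg => zs _; apply: eq_avg => z _.
  by rewrite subnn mul1r.
have Skle i : (i <= k)%N -> S k <= S i.
  move=> ik; apply: le_avg => zs _; apply: le_avg => z _.
  rewrite subnn mul1r -{1}(subnK ik) exprD ler_wpM2r ?exprn_ge0//.
  by rewrite lerXn2r ?nnegrE// ca.
(* Telescoping over the [k] edges at the new column vertex. *)
have [|i ik Si] := exists_ratio_ge (u := S) tau0 k0.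
  by rewrite S0 Sk.
(* The free end of edge [i] and the [k - i.+1] later rows have been
   integrated out, so that a configuration only keeps [i] rows. *)
pose w zs (ys : {ffun 'I_i -> Y}) := a zs ^+ (k - i.+1) * \prod_j G zs (ys j).
have w0 zs ys : 0 <= w zs ys.
  by rewrite mulr_ge0 ?exprn_ge0 ?prodr_ge0.
(* The edges from [z] to the retained rows; [G zs] and [H ys] are the candidates for [g1] and
   [g2]. *)
pose H (ys : {ffun 'I_i -> Y}) z := \prod_j F (ys j) z.
have H01 ys z : 0 <= H ys z <= 1 by apply: prod01.
have H0 ys z : 0 <= H ys z by have /andP[] := H01 ys z.
pose b ys := avg D (H ys).
have b0 ys : 0 <= b ys by apply: avg_ge0.
have b1 ys : b ys <= 1.
  by apply: avg_le_cst => // z _; have /andP[] := H01 ys z.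
pose t zs ys := avg A (fun y => avg D (fun z => G zs y * H ys z * F y z)).
(* The power [c zs z ^+ i] is an average over [i] independent rows [ys], whose edges to [z] form
   [H ys z]. *)
have cE zs (x : R) (g : Z -> R) : avg D (fun z => x * (c zs z ^+ i * g z)) =
    avg (tuples i A) (fun ys => x * \prod_j G zs (ys j) *
       avg D (fun z => H ys z * g z)).
  under [RHS]eq_avg => ys _ do rewrite -avgZ.
  rewrite exchange_avg; apply: eq_avg => z _.
  rewrite -avg_tuples_exp mulrA mulrAC -avgZ; apply: eq_avg => ys _.
  by rewrite big_split/= -/(H ys z); ring.
have tE zs ys : t zs ys = avg D (fun z => H ys z * c zs z).
  rewrite /t exchange_avg; apply: eq_avg => z _.
  by rewrite -avgZ; apply: eq_avg => y _; ring.
have ta zs ys : t zs ys <= a zs * b ys.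
  by rewrite tE -avgZ; apply: le_avg => z _; rewrite mulrC ler_wpM2r.
have SiE : S i = avg (tuples l D) (fun zs => avg (tuples i A) (fun ys =>
    w zs ys * (a zs * b ys))).
  apply: eq_avg => zs _.
  under eq_avg => z _ do
    rewrite -subnSK// exprSr -mulrA [a zs * _]mulrC.
  rewrite (cE zs _ (fun=> a zs)); apply: eq_avg => ys _.
  by under eq_avg => z _ do rewrite mulrC; rewrite avgZ.
have SSiE : S i.+1 = avg (tuples l D) (fun zs => avg (tuples i A) (fun ys =>
    w zs ys * t zs ys)).
  apply: eq_avg => zs _.
  under eq_avg => z _ do rewrite exprSr.
  by rewrite cE; apply: eq_avg => ys _; rewrite tE.
(* Averaged over [zs], this mass is [M]; it normalises the error terms. *)
have wE zs : avg (tuples i A) (fun ys => w zs ys * a zs) = a zs ^+ k.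
  under eq_avg => ys _ do rewrite /w mulrAC -exprSr.
  by rewrite avgZ avg_tuples_exp -exprD -subSn// subSS subnK// ltnW.
case: (boolP [exists zs : {ffun 'I_l -> Z}, exists ys : {ffun 'I_i -> Y},
  [&& (1 - eps) * tau * (a zs * b ys) <= t zs ys,
      delta <= a zs & delta <= b ys]]) => [|none].
  by move=> /existsP[zs /existsP[ys /and3P[? ? ?]]]; exists (G zs), (H ys).
have ab_le zs ys : a zs * b ys <= a zs by rewrite ler_piMr.
have p0 : 0 <= (1 - eps) * tau by rewrite mulr_ge0 ?subr_ge0// ltW.
(* If [a zs] or [b ys] is at most [delta], the error term absorbs [t zs ys <= a zs * b ys];
   otherwise the density test fails by assumption. *)
have tle zs ys : t zs ys <= (1 - eps) * tau * (a zs * b ys)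
    + (delta + (a zs <= delta)%R%:R) * a zs.
  have pab : 0 <= (1 - eps) * tau * (a zs * b ys).
    by rewrite (mulr_ge0 p0)// mulr_ge0.
  have da : 0 <= delta * a zs by rewrite mulr_ge0.
  have tab := ta zs ys; have aba := ab_le zs ys.
  have [az|az] := lerP (a zs) delta => /=; first lra.
  have [bz|bz] := lerP (b ys) delta => /=.
    by have := ler_wpM2l (a0 zs) bz; lra.
  move: none; rewrite negb_exists => /forallP/(_ zs).
  rewrite negb_exists => /forallP/(_ ys).
  by rewrite !(ltW az, ltW bz) !andbT -ltNge mulr0n; lra.
have : S i.+1 <= (1 - eps) * tau * S i + (delta * M + delta ^+ k).
  have -> : M = avg (tuples l D) (fun zs => a zs ^+ k) by rewrite /M grid2_col.
  have small_a : avg (tuples l D) (fun zs => (a zs <= delta)%R%:R * a zs ^+ k)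
      <= delta ^+ k.
    apply: avg_le_cst => [|zs _]; first exact: exprn_ge0.
    have [az|az] := lerP (a zs) delta; last by rewrite mul0r exprn_ge0.
    by rewrite mul1r lerXn2r ?nnegrE.
  apply: le_trans (lerD (lexx _) (lerD (lexx _) small_a)).
  rewrite SiE SSiE -!avgZ -!avgD; apply: le_avg => zs _.
  rewrite -mulrDl -wE -!avgZ -avgD; apply: le_avg => ys _.
  apply: le_trans (ler_wpM2l (w0 zs ys) (tle zs ys)) _.
  by rewrite mulrDr !(mulrCA (w zs ys)).
(* With [tau * S i <= S i.+1], the last bound gives [eps * tau * S i <= delta * M + delta ^+ k];
   since [tau ^+ k * M <= S i], this contradicts [small]. *)
have := Skle i (ltnW ik).
rewrite Sk => /(le_trans step) MSi.
have := ler_wpM2l (mulr_ge0 eps0 (ltW tau0)) MSi.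
lra.
Qed.

(** * Choice of the column and of the cutoff *)

Lemma grid2_antitone_r (R : realType) (Y Z : finType) (F : Y -> Z -> R)
    (A : {set Y}) (D : {set Z}) (k l m : nat) :
  (forall y z, 0 <= F y z <= 1) -> (l <= m)%N ->
  grid2 F A D k m <= grid2 F A D k l.
Proof.
move=> F01 lm; rewrite !grid2_row; apply: le_avg => y _.
have H01 z : 0 <= \prod_i F (y i) z <= 1 by apply: prod01.
rewrite ler_wiXn2l// ?avg_ge0 ?avg_le_cst// => z _.
- by have /andP[] := H01 z.
- by have /andP[] := H01 z.
Qed.

Lemma exists_dense_weights_of_grid2 (R : realType) (Y Z : finType)
    (F : Y -> Z -> R) (A : {set Y}) (D : {set Z}) (k : nat) (tau eps : R) :
  (forall y z, 0 <= F y z <= 1) -> (0 < k)%N -> 0 < tau < 1 -> 0 < eps <= 1 ->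
  tau ^+ (k * k) <= grid2 F A D k k ->
  exists (g1 : Y -> R) (g2 : Z -> R),
    [/\ forall y, 0 <= g1 y <= 1, forall z, 0 <= g2 z <= 1,
        (1 - eps) * tau * (avg A g1 * avg D g2)
          <= avg A (fun y => avg D (fun z => g1 y * g2 z * F y z)),
        eps * tau ^+ (2 * k) <= avg A g1 & eps * tau ^+ (2 * k) <= avg D g2].
Proof.
move=> F01 k0 /andP[tau0 tau1] /andP[eps0 eps1] Ftau.
have taun0 n : 0 < tau ^+ n by rewrite exprn_gt0.
have [y] := exists_ge_avg (taun0 _) Ftau.
rewrite inE => /forallP/(_ (Ordinal k0)) yA /(exists_ge_avg (taun0 _))[z].
rewrite inE => /forallP/(_ (Ordinal k0)) zD _.
have A0 : A != set0 by apply/set0Pn; exists (y (Ordinal k0)).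
have D0 : D != set0 by apply/set0Pn; exists (z (Ordinal k0)).
have [mean_big|tau_small] := lerP ((1 - eps) * tau) (tau ^+ k).
  exists (fun=> 1), (fun=> 1); rewrite !avg_cst// !mulr1.
  have ed : eps * tau ^+ (2 * k) <= 1.
    by rewrite mulr_ile1// ?exprn_ile1// ltW.
  split => //; [by move=> _; rewrite ler01 lexx.. | ].
  rewrite (le_trans mean_big)//.
  under eq_avg => u _ do under eq_avg => v _ do rewrite !mul1r.
  have F0 : 0 <= avg A (fun y => avg D (F y)).
    apply: avg_ge0 => y' _; apply: avg_ge0 => z' _.
    by have /andP[] := F01 y' z'.
  (* The diagonal bound applies to [k]-th powers of the mean. *)
  rewrite -(@ler_pXn2r _ k)// ?nnegrE ?(ltW (taun0 _))//.
  by rewrite -exprM (le_trans Ftau)// grid2_le_diag.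
pose u l := grid2 F A D k l.
have u0 : u 0%N <= 1.
  rewrite /u grid2_row; apply: avg_le_cst => // y' _.
(* In [k] steps [u] goes from at most 1 to at least [tau ^+ (k * k)], hence the ratio [tau ^+ k]. *)
have [|l lk ul] := exists_ratio_ge (u := u) (taun0 k) k0.
  by rewrite -exprM (le_trans _ Ftau)// ler_piMr ?(ltW (taun0 _)).
have Mtau : tau ^+ (k * k) <= u l.
  by rewrite (le_trans Ftau)// grid2_antitone_r// ltnW.
set delta := eps * _.
have delta0 : 0 < delta by rewrite mulr_gt0.
apply: (@exists_dense_weights _ _ _ F A D k l) => //.
- by rewrite (ltW eps0).
- exact: ltW.
rewrite -/(u l).
(* For [k = 1] the case assumption would read [tau < (1 - eps) * tau]. *)
have k1 : (1 < k)%N.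
  rewrite ltn_neqAle k0 andbT; apply: contraTneq tau_small => <-.
  by rewrite expr1 -leNgt ler_piMl ?(ltW tau0)// gerBl ltW.
(* As [k] is at least 2, [eps ^+ k.-1 <= eps] and [k * k <= 2 * k * k.-1]. *)
have pow : delta ^+ k <= delta * (eps * u l).
  rewrite -[k in leLHS]prednK// exprS ler_pM2l// exprMn.
  rewrite ler_pM ?exprn_ge0 ?(ltW eps0) ?(ltW (taun0 _)) ?(ltW tau0)//.
    have k2 : (1 <= k.-1)%N by rewrite -subn1 subn_gt0.
    by have := ler_wiXn2l (ltW eps0) eps1 k2.
  rewrite (le_trans _ Mtau)// -exprM.
  by have := ler_wiXn2l (ltW tau0) (ltW tau1) (_ : (_ <= _)%N); apply;
    rewrite mulnAC mulnC leq_pmul2l//; clear -k1; lia.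
have ul0 : 0 < u l by apply: lt_le_trans Mtau.
rewrite (le_lt_trans (lerD (lexx _) pow))//.
rewrite /delta mul2n -addnn exprD.
(* The goal divided by [eps * tau ^+ k * u l]; it follows from [(1 - eps) * (1 + eps) <= 1]. *)
have tk : tau ^+ k * (1 + eps) < tau.
  apply: (@lt_le_trans _ _ ((1 - eps) * tau * (1 + eps))).
    by rewrite ltr_pM2r// addr_gt0.
  rewrite (_ : _ * (1 + eps) = tau * (1 - eps ^+ 2)); last by ring.
  by rewrite ler_piMr ?(ltW tau0)// gerBl sqr_ge0.
move: (u l) (tau ^+ k) ul0 (taun0 k) tk => m q m0 q0 q_small.
rewrite (_ : _ + _ = (eps * q * m) * (q * (1 + eps))); last by ring.
rewrite (_ : eps * tau * _ = (eps * q * m) * tau); last by ring.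
by rewrite ltr_pM2l// !mulr_gt0.
Qed.

(** * Passage from the grid norm to a fixed translate *)

Theorem theorem6p17 (R : realType) :
  exists C : nat, forall (G : finZmodType) (K d : nat) (eta tau : R)
    (B : nat -> bohr R G d) (f : G -> R) (eps : R),
  let B1 := bohr_set (B 0%N) in
  let B2 := bohr_set (B 1%N) in
  let B3 := bohr_set (B 2%N) in
  (1 <= K)%N -> 0 < eta < 1 / 2 -> 0 < tau < 1 ->
  small_seq eta B ->
  (forall x, 0 <= f x <= 1) ->
  tau <= grid_norm f B1 B2 B3 K K ->
  0 < eps <= 1 ->
  exists (g1 g2 : G -> R) (x : G),
    [/\ forall y, y \in B2 -> 0 <= g1 y <= 1,
        forall z, z \in B3 -> 0 <= g2 z <= 1,
        x \in B1,
        (1 - eps) * tau * (\avg_(y in B2) \avg_(z in B3) (g1 y * g2 z))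
          <= \avg_(y in B2) \avg_(z in B3) (g1 y * g2 z * f (x + y + z))
      & eps * tau ^+ (C * K) <= \avg_(y in B2) g1 y
        /\ eps * tau ^+ (C * K) <= \avg_(z in B3) g2 z].
Proof.
(* The constant 2 comes from the cutoff [eps * tau ^+ (2 * K)]. *)
exists 2 => G K d eta tau B f eps B1 B2 B3 K0 _ /andP[tau0 tau1] _ f01.
move=> normf eps01.
have f_grid2 x : 0 <= grid2 (fun y z => f (x + y + z)) B2 B3 K K.
  rewrite /grid2; apply: avg_ge0 => y _; apply: avg_ge0 => z _.
  apply: prodr_ge0 => i _; apply: prodr_ge0 => j _.
  by have /andP[] := f01 (x + y i + z j).
have grid_tau : tau ^+ (K * K) <= grid_avg f B1 B2 B3 K K.
  have g0 : 0 <= grid_avg f B1 B2 B3 K K.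
    by apply: avg_ge0 => x _; apply: f_grid2.
  have KK0 : (K * K)%:R != 0 :> R by rewrite pnatr_eq0 muln_eq0 orbb -lt0n.
  rewrite (le_trans (lerXn2r (K * K)%N _ _ normf)) ?nnegrE ?(ltW tau0)//.
    exact: powR_ge0.
  by rewrite -powR_mulrn ?powR_ge0// -powRrM mulVf// powRr1.
have [x xB1 gridx] := exists_ge_avg (exprn_gt0 _ tau0) grid_tau.
have tau01 : 0 < tau < 1 by rewrite tau0.
have [g1 [g2 [g101 g201 main d1 d2]]] := exists_dense_weights_of_grid2
  (F := fun y z => f (x + y + z)) (fun y z => f01 _) K0 tau01 eps01 gridx.
exists g1, g2, x; split => //.
(* The average of [g1 y * g2 z] is the product of the two means. *)
rewrite (eq_avg (H := fun y => avg B3 g2 * g1 y)) => [|y _]; last first.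
  by rewrite avgZ mulrC.
by rewrite avgZ [X in _ * X]mulrC.
Qed.
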